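(* Let $n\ge0$ be an integer. For each initial condition $q^{(0)}=\{q_t^{(0)}(u_t|x_t,u_{t-n}^{t-1})\}_{t=1}^T$ with all entries strictly positive, the sequence $q^{(k)}=\{q_t^{(k)}\}_{t=1}^T$, $k=1,2,\dots$, generated by the forward-backward Arimoto-Blahut algorithm (defined in the context) has a limit point. Moreover, every limit point $q^*=\{q_t^*\}_{t=1}^T$ satisfies the following system: there exist $\{\mu_{t+1}^*,\nu_t^*,\rho_t^*,\phi_t^*\}_{t=1}^T$ (with each $\nu_t^*(\cdot|u_{t-n}^{t-1})$ a probability distribution on $\mathcal U_t$) such that, with $\mu_1^*(x_1)=\mu_1(x_1)$ and $\phi_{T+1}^*(x_{T+1},u_{T-n+1}^T)=\exp\{-c_{T+1}(x_{T+1})\}$, for every $t=1,\dots,T$: $$\mu_{t+1}^*(x_{t+1},u_{t-n+1}^t)=\sum_{x_t\in\mathcal X_t}\sum_{u_{t-n}\in\mathcal U_{t-n}}p_{t+1}(x_{t+1}|x_t,u_t)\,q_t^*(u_t|x_t,u_{t-n}^{t-1})\,\mu_t^*(x_t,u_{t-n}^{t-1}),$$ $$\nu_t^*(u_t|u_{t-n}^{t-1})=\sum_{x_t\in\mathcal X_t}q_t^*(u_t|x_t,u_{t-n}^{t-1})\,\mu_t^*(x_t|u_{t-n}^{t-1})\quad\text{for all }u_{t-n}^{t-1}\text{ with }\mu_t^*(u_{t-n}^{t-1})>0,$$ $$\rho_t^*(x_t,u_{t-n}^t)=c_t(x_t,u_t)-\sum_{x_{t+1}\in\mathcal X_{t+1}}p_{t+1}(x_{t+1}|x_t,u_t)\log\phi_{t+1}^*(x_{t+1},u_{t-n+1}^t),$$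 $$\phi_t^*(x_t,u_{t-n}^{t-1})=\sum_{u_t\in\mathcal U_t}\nu_t^*(u_t|u_{t-n}^{t-1})\exp\{-\rho_t^*(x_t,u_{t-n}^t)\},$$ $$q_t^*(u_t|x_t,u_{t-n}^{t-1})=\frac{\nu_t^*(u_t|u_{t-n}^{t-1})\exp\{-\rho_t^*(x_t,u_{t-n}^t)\}}{\phi_t^*(x_t,u_{t-n}^{t-1})}\quad\text{for all }(x_t,u_{t-n}^{t-1})\text{ with }\mu_t^*(x_t,u_{t-n}^{t-1})>0.$$
   Context: Setting. $T\ge1$ is a time horizon; for each $t$, the state space $\mathcal X_t$ and action space $\mathcal U_t$ are finite; $p_{t+1}(x_{t+1}|x_t,u_t)$ is a given transition probability; $c_t:\mathcal X_t\times\mathcal U_t\to\mathbb R$ ($t=1,\dots,T$) and $c_{T+1}:\mathcal X_{T+1}\to\mathbb R$ are cost functions; $\mu_1(x_1)$ is a given initial distribution. Notation: $x_k^l=(x_k,\dots,x_l)$; subsequences are truncated to indices $\ge1$ (so $u_{t-n}^{t-1}$ means $u_{\max(1,t-n)}^{t-1}$, and a sum over $u_{t-n}$ is omitted if $t-n<1$), and $u_t^{t-1}$ (e.g. when $n=0$) is empty. $\log$ is the natural logarithm. Marginals and conditionals of a distribution are denoted by the same letter. A policy $q=\{q_t(u_t|x_t,u_{t-n}^{t-1})\}_{t=1}^T$ consists of conditional probability distributions on $\mathcal U_t$ given $(x_t,u_{t-n}^{t-1})$, regarded as an element of a finite-dimensional Euclidean space; limit points are taken in that space. Forward-backward Arimoto-Blahut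 algorithm. Start from a policy $q^{(0)}$ with all entries positive. Set $\mu_1^{(k)}=\mu_1$ and $\phi_{T+1}^{(k)}(x_{T+1},u_{T+1-n}^T)=\exp\{-c_{T+1}(x_{T+1})\}$ for all $k$. For $k=1,2,\dots$: Forward path, for $t=1,2,\dots,T$: $$\mu_{t+1}^{(k)}(x_{t+1},u_{t-n+1}^t)=\sum_{x_t}\sum_{u_{t-n}}p_{t+1}(x_{t+1}|x_t,u_t)q_t^{(k-1)}(u_t|x_t,u_{t-n}^{t-1})\mu_t^{(k)}(x_t,u_{t-n}^{t-1}),$$ $$\nu_t^{(k)}(u_t|u_{t-n}^{t-1})=\sum_{x_t}q_t^{(k-1)}(u_t|x_t,u_{t-n}^{t-1})\mu_t^{(k)}(x_t|u_{t-n}^{t-1})$$ (by convention $\nu_t^{(k)}(\cdot|u_{t-n}^{t-1})$ is uniform on $\mathcal U_t$ if $\mu_t^{(k)}(u_{t-n}^{t-1})=0$). Backward path, for $t=T,T-1,\dots,1$: $$\rho_t^{(k)}(x_t,u_{t-n}^t)=c_t(x_t,u_t)-\sum_{x_{t+1}}p_{t+1}(x_{t+1}|x_t,u_t)\log\phi_{t+1}^{(k)}(x_{t+1},u_{t-n+1}^t),$$ $$\phi_t^{(k)}(x_t,u_{t-n}^{t-1})=\sum_{u_t}\nu_t^{(k)}(u_t|u_{t-n}^{t-1})\exp\{-\rho_t^{(k)}(x_t,u_{t-n}^t)\},$$ $$q_t^{(k)}(u_t|x_t,u_{t-n}^{t-1})=\frac{\nu_t^{(k)}(u_t|u_{t-n}^{t-1})\exp\{-\rho_t^{(k)}(x_t,u_{t-n}^t)\}}{\phi_t^{(k)}(x_t,u_{t-n}^{t-1})}.$$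 *)

(* Defs.v *)
From HB Require Import structures.
From mathcomp Require Import all_boot all_order all_algebra.
From mathcomp Require Import all_classical all_reals all_analysis.

Set Implicit Arguments.
Unset Strict Implicit.
Unset Printing Implicit Defensive.

Import Order.TTheory GRing.Theory Num.Theory.
Import numFieldNormedType.Exports.

Local Open Scope classical_set_scope.
Local Open Scope ring_scope.

(* Time is counted from 0: index [t] stands for the usual t+1. Thus the states
   live in X 0, ..., X T, the actions in U 0, ..., U T.-1, the initial state
   is in X 0 and the terminal cost is a function on X T. The values of X and U
   at larger indices are never used. *)

Definition is_dist (R : realType) (A : finType) (f : A -> R) : Prop :=
  (forall a, 0 <= f a) /\ \sum_a f a = 1.

Section Window.
Variable U : nat -> finType.

(* [window m t] is the type of the (at most) m actions preceding time t,
   truncated at time 0, stored oldest first in left-nested pairs. In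
   particular [window m.+1 t.+1] is convertible to [window m t * U t]. *)
Fixpoint window (m t : nat) {struct t} : finType :=
  match t, m with
  | t'.+1, m'.+1 => (window m' t' * U t')%type
  | _, _ => unit
  end.

Fixpoint drop_oldest (m t : nat) {struct t} : window m.+1 t -> window m t :=
  match t return window m.+1 t -> window m t with
  | 0 => fun=> tt
  | t'.+1 =>
    match m return window m.+1 t'.+1 -> window m t'.+1 with
    | 0 => fun=> tt
    | m'.+1 => fun w => (@drop_oldest m' t' w.1, w.2)
    end
  end.

(* (u_{t-m}^{t-1}, u_t) |-> u_{t-m+1}^t *)
Definition shift_window (m t : nat) (w : window m t) (u : U t) :
    window m t.+1 :=
  @drop_oldest m t.+1 (w, u).

End Window.

Arguments shift_window {U m t} w u.

Section Problem.
Variables (R : realType) (T : nat) (X U : nat -> finType).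
Variables (p : forall t : 'I_T, X t -> U t -> X t.+1 -> R)
          (c : forall t : 'I_T, X t -> U t -> R)
          (cT : X T -> R) (mu1 : X 0 -> R) (n : nat).

(* A finite product of copies of R with the product topology; the entry
   [q t (x, w, u)] is q_t(u | x, w). Being a family of conditional
   distributions is the separate predicate [is_policy]. *)
Definition policy :=
  prod_topology
    (fun t : 'I_T => prod_topology (fun _ : X t * window U n t * U t => R)).

HB.instance Definition _ := Uniform.copy policy
  (prod_topology (fun t : 'I_T =>
     prod_topology (fun _ : X t * window U n t * U t => R : uniformType)
       : uniformType)).

Definition is_policy (q : policy) : Prop :=
  forall (t : 'I_T) (x : X t) (w : window U n t),
    is_dist (fun u : U t => q t (x, w, u)).

Definition positive_policy (q : policy) : Prop :=
  forall (t : 'I_T) (x : X t) (w : window U n t) (u : U t), 0 < q t (x, w, u).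

Definition marginal (t : nat) (mu : X t -> window U n t -> R)
    (w : window U n t) : R :=
  \sum_x mu x w.

Definition conditional (t : nat) (mu : X t -> window U n t -> R)
    (x : X t) (w : window U n t) : R :=
  mu x w / marginal mu w.

(* The constraint [shift_window w u == v] fixes u and all of w except the
   action dropped from the window, so the two inner sums amount to the sum over
   u_{t-n}, and to a single term when t < n. For n = 0 the dropped action is
   u_t itself. *)
Definition mu_system (q : policy)
    (mu : forall t : nat, X t -> window U n t -> R) : Prop :=
  (forall (x : X 0) (w : window U n 0), mu 0%N x w = mu1 x) /\
  (forall (t : 'I_T) (x' : X t.+1) (v : window U n t.+1),
    mu t.+1 x' v =
      \sum_(x : X t) \sum_(w : window U n t)
        \sum_(u : U t | shift_window w u == v)
          p x u x' * q t (x, w, u) * mu t x w).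

Definition output_dist (q : policy)
    (mu : forall t : nat, X t -> window U n t -> R)
    (t : 'I_T) (w : window U n t) (u : U t) : R :=
  \sum_(x : X t) q t (x, w, u) * conditional (mu t) x w.

Definition rho_phi_system (nu : forall t : 'I_T, window U n t -> U t -> R)
    (rho : forall t : 'I_T, X t -> window U n t -> U t -> R)
    (phi : forall t : nat, X t -> window U n t -> R) : Prop :=
  [/\ forall (x : X T) (w : window U n T), phi T x w = expR (- cT x),
      forall (t : 'I_T) (x : X t) (w : window U n t) (u : U t),
        rho t x w u =
          c x u - \sum_(x' : X t.+1)
                    p x u x' * ln (phi t.+1 x' (shift_window w u))
    & forall (t : 'I_T) (x : X t) (w : window U n t),
        phi t x w = \sum_(u : U t) nu t w u * expR (- rho t x w u)].

Definition fb_ab_step (q q' : policy) : Prop :=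
  exists (mu : forall t : nat, X t -> window U n t -> R)
    (nu : forall t : 'I_T, window U n t -> U t -> R)
    (rho : forall t : 'I_T, X t -> window U n t -> U t -> R)
    (phi : forall t : nat, X t -> window U n t -> R),
  [/\ mu_system q mu,
      forall (t : 'I_T) (w : window U n t) (u : U t),
        nu t w u = if marginal (mu t) w == 0 then #|U t|%:R^-1
                   else output_dist q mu w u,
      rho_phi_system nu rho phi
    & forall (t : 'I_T) (x : X t) (w : window U n t) (u : U t),
        q' t (x, w, u) = nu t w u * expR (- rho t x w u) / phi t x w].

Definition fb_ab_sequence (q0 : policy) (q : nat -> policy) : Prop :=
  q 0%N = q0 /\ forall k, fb_ab_step (q k) (q k.+1).

Definition optimality_system (q : policy) : Prop :=
  exists (mu : forall t : nat, X t -> window U n t -> R)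
    (nu : forall t : 'I_T, window U n t -> U t -> R)
    (rho : forall t : 'I_T, X t -> window U n t -> U t -> R)
    (phi : forall t : nat, X t -> window U n t -> R),
  [/\ mu_system q mu,
      forall (t : 'I_T) (w : window U n t), is_dist (nu t w),
      forall (t : 'I_T) (w : window U n t) (u : U t),
        0 < marginal (mu t) w -> nu t w u = output_dist q mu w u,
      rho_phi_system nu rho phi
    & forall (t : 'I_T) (x : X t) (w : window U n t) (u : U t),
        0 < mu t x w ->
        q t (x, w, u) = nu t w u * expR (- rho t x w u) / phi t x w].

(* [fb_ab_step] is the graph of a function, so that [fb_ab_sequence q0]
   determines exactly one sequence. *)
Lemma fb_ab_step_ex (q : policy) : exists q', fb_ab_step q q'.
Proof.
pose mu := fix mu (t : nat) : X t -> window U n t -> R :=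
  match t return X t -> window U n t -> R with
  | 0 => fun x _ => mu1 x
  | s.+1 => fun x' v => match @idP (s < T)%N with
    | ReflectT h => \sum_(x : X s) \sum_(w : window U n s)
        \sum_(u : U s | shift_window w u == v)
          p (t := Ordinal h) x u x' * q (Ordinal h) (x, w, u) * mu s x w
    | _ => 0 end
  end.
pose nu (t : 'I_T) (w : window U n t) (u : U t) : R :=
  if marginal (mu t) w == 0 then #|U t|%:R^-1 else output_dist q mu w u.
pose rho_of (t : 'I_T) (f : X t.+1 -> window U n t.+1 -> R)
    (x : X t) (w : window U n t) (u : U t) : R :=
  c x u - \sum_(x' : X t.+1) p x u x' * ln (f x' (shift_window w u)).
pose fin : forall t, X t -> window U n t -> R :=
  @eqtype.dfwith _ (fun t => X t -> window U n t -> R) (fun _ _ _ => 0) T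
          (fun x _ => expR (- cT x)).
pose bwd := fix bwd (s t : nat) : X t -> window U n t -> R :=
  match s with
  | 0 => fin t
  | s'.+1 => fun x w => match @idP (t < T)%N with
    | ReflectT h => \sum_(u : U t) nu (Ordinal h) w u *
        expR (- rho_of (Ordinal h) (bwd s' t.+1) x w u)
    | _ => 0 end
  end.
pose phi t := bwd (T - t)%N t.
pose rho (t : 'I_T) := rho_of t (phi t.+1).
exists (fun t z => nu t z.1.2 z.2 * expR (- rho t z.1.1 z.1.2 z.2) /
                   phi t z.1.1 z.1.2).
exists mu, nu, rho, phi; split=> //.
  split=> // -[t ht] x' v /=; case: {-}_ / idP => [h|//].
  by rewrite (bool_irrelevance h ht).
split=> //.
  by move=> x w; rewrite /phi subnn /= /fin eqtype.dfwith_in.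
move=> [t ht] x w; rewrite {1}/phi /= -(subnSK ht) /=.
case: {-}_ / idP => [h|//]; rewrite (bool_irrelevance h ht).
by [].
Qed.

Lemma fb_ab_step_uniq (q q1 q2 : policy) :
  fb_ab_step q q1 -> fb_ab_step q q2 -> q1 = q2.
Proof.
move=> [mu [nu [rho [phi [[mu0 muS] nuE [phiT rhoE phiE] qE]]]]].
move=> [mu' [nu' [rho' [phi' [[mu0' muS'] nuE' [phiT' rhoE' phiE'] qE']]]]].
have eq_mu t : (t <= T)%N -> mu t = mu' t.
  elim: t => [_|t IH ht]; apply/funext => x; apply/funext => w.
    by rewrite mu0 mu0'.
  by rewrite (muS (Ordinal ht)) (muS' (Ordinal ht)) /= IH // ltnW.
have eq_nu t w u : nu t w u = nu' t w u.
  by rewrite nuE nuE' /output_dist eq_mu // ltnW.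
have eq_rho (t : 'I_T) : phi t.+1 = phi' t.+1 -> rho t = rho' t.
  move=> e; apply/funext => x; apply/funext => w; apply/funext => u.
  by rewrite rhoE rhoE' e.
have eq_phi s : forall t, (t + s)%N = T -> phi t = phi' t.
  elim: s => [|s IH] t.
    rewrite addn0 => ->; apply/funext => x; apply/funext => w.
    by rewrite phiT phiT'.
  move=> e; have ht : (t < T)%N by rewrite -e addnS ltnS leq_addr.
  apply/funext => x; apply/funext => w.
  rewrite (phiE (Ordinal ht)) (phiE' (Ordinal ht)) eq_rho; last first.
    by apply: IH; rewrite addSnnS.
  by apply: eq_bigr => u _; rewrite eq_nu.
apply: functional_extensionality_dep => t; apply/funext => -[[x w] u].
rewrite qE qE' eq_nu eq_rho; last first.
  by apply: (eq_phi (T - t.+1)%N); exact: subnKC.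
by rewrite (eq_phi (T - t)%N) // subnKC // ltnW.
Qed.

End Problem.

(* Main.v *)
Require Import Defs.
From mathcomp Require Import all_boot all_order all_algebra.
From mathcomp Require Import all_classical all_reals all_analysis.
From mathcomp Require Import ring lra.

Set Implicit Arguments.
Unset Strict Implicit.
Unset Printing Implicit Defensive.

Import Order.TTheory GRing.Theory Num.Theory.
Import numFieldNormedType.Exports.

Local Open Scope classical_set_scope.
Local Open Scope ring_scope.

(** The algorithm is an alternating minimization of the regularized cost

      F (q, nu) = E_q [total cost] +
        sum over t of E_q [ln (q_t (u | x, w) / nu_t (u | w))],

    where w is the window of recent actions. For fixed q the minimizing nu is
    the law of the action given the window (forward path); for fixed nu the
    minimizing q is the Gibbs policy obtained by dynamic programming (backward
    path), and the minimal value is minus the expectation of ln phi_0 under the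
    initial law. Hence the value E [ln phi_0] never decreases.

    Everything rests on how much it increases ([total_gain_ge]). Gibbs'
    variational inequality [gibbs_variational] bounds ln (phi'_t / phi_t) from
    below by the policy average of ln (nu'_t / nu_t) plus the transition
    average of ln (phi'_{t+1} / phi_{t+1}). Averaging over the occupation
    measures mu_t of the current policy, the second part becomes the same
    expected gain at time t+1, and the first part becomes the relative entropy
    of nu'_t with respect to nu_t, which dominates a quarter of the squared
    distance between them ([expected_gain_step]). Thus every squared change of
    nu, weighted by the marginal of mu, is at most four times the gain of one
    iteration.

    Policies lie in a compact box, so limit points exist. Given a limit point
    q*, an ultrafilter on the iteration numbers along which the policies
    converge to q* makes the bounded nu converge too, and then phi and rho by
    backward recursion and mu by forward recursion. The nondecreasing values
    converge along this ultrafilter, so the gains tend to 0. All equations pass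
    to the limit directly except the one for nu, because the law of the action
    given the window is discontinuous where the window has probability 0, and
    because the forward path of q_{k+1} yields nu_{k+1} whereas q_{k+1} was
    built from nu_k. Both difficulties disappear in the product form
    P (u, w) = mu (w) nu (u | w): its two sides are continuous, it holds for
    q_{k+1} and nu_{k+1}, and replacing nu_{k+1} by nu_k costs an error that
    the vanishing gain controls. *)

(** * Entropy inequalities *)

Section EntropyInequalities.
Variable R : realType.

Lemma ln_le_subr1 (x : R) : 0 < x -> ln x <= x - 1.
Proof.
move=> x0; have := @le_ln1Dx R (x - 1); rewrite addrCA subrr addr0; apply.
by rewrite ltrBrDl subrr.
Qed.

Lemma is_dist_le1 (A : finType) (f : A -> R) a : is_dist f -> f a <= 1.
Proof.
move=> [f0 <-]; rewrite (bigD1 a) //= lerDl; exact: sumr_ge0.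
Qed.

Lemma is_dist_gt0_ex (A : finType) (f : A -> R) :
  is_dist f -> exists a, 0 < f a.
Proof.
move=> [f0 f1]; apply: contrapT => /forallNP H.
have : \sum_a f a = 0.
  apply: big1 => a _; apply/eqP; rewrite eq_le f0 andbT leNgt.
  exact/negP/H.
by rewrite f1 => /eqP; rewrite oner_eq0.
Qed.

(** Concavity of ln, in the form ln z <= z - 1 applied to z = g / (q G) with
    G the sum of g. Equality holds when q is g normalized, which is why the
    Gibbs policy is the optimal response to a fixed nu. *)
Lemma gibbs_variational (A : finType) (q g : A -> R) :
  is_dist q -> (forall a, 0 < q a) -> (forall a, 0 < g a) ->
  \sum_a q a * (ln (g a) - ln (q a)) <= ln (\sum_a g a).
Proof.
move=> dq q0 g0; have [a0 _] := is_dist_gt0_ex dq.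
have q1 : \sum_a q a = 1 by case: dq.
set G := \sum_a g a.
have G0 : 0 < G.
  by rewrite /G (bigD1 a0) //= ltr_pwDl // sumr_ge0 // => a _; exact/ltW.
suff : \sum_a q a * (ln (g a) - ln (q a)) - ln G <= 0 by rewrite subr_le0.
have -> : \sum_a q a * (ln (g a) - ln (q a)) - ln G =
          \sum_a q a * ln (g a / (q a * G)).
  have {1}-> : ln G = \sum_a q a * ln G by rewrite -mulr_suml q1 mul1r.
  rewrite -sumrB; apply: eq_bigr => a _.
  rewrite ln_div ?posrE ?mulr_gt0// lnM ?posrE//; ring.
have s0 : \sum_a (g a / G - q a) = 0.
  by rewrite sumrB q1 -mulr_suml divff ?subrr ?gt_eqF.
rewrite -[leRHS]s0; apply: ler_sum => a _.
have -> : g a / G - q a = q a * (g a / (q a * G) - 1).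
  by field; rewrite !gt_eqF.
by rewrite ler_pM2l// ln_le_subr1// divr_gt0// mulr_gt0.
Qed.

(** Pinsker-type bound, one letter at a time. The terms - a + b cancel when
    summed over two distributions; they make each term nonnegative on its own.
    With s and r the square roots of a and b, ln z <= z - 1 at z = r / s gives
    the lower bound (s - r)^2, and s + r <= 2 turns it into the claim. *)
Lemma relative_entropy_term_ge (a b : R) : 0 < a <= 1 -> 0 < b <= 1 ->
  (a - b) ^+ 2 / 4 <= a * (ln a - ln b) - a + b.
Proof.
move=> /andP[a0 a1] /andP[b0 b1].
set s := Num.sqrt a; set r := Num.sqrt b.
have s0 : 0 < s by rewrite sqrtr_gt0.
have r0 : 0 < r by rewrite sqrtr_gt0.
have s1 : s <= 1 by rewrite -[leRHS]sqrtr1 ler_wsqrtr.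
have r1 : r <= 1 by rewrite -[leRHS]sqrtr1 ler_wsqrtr.
have -> : a = s * s by rewrite -expr2 sqr_sqrtr// ltW.
have -> : b = r * r by rewrite -expr2 sqr_sqrtr// ltW.
rewrite !lnM ?posrE//.
have := @ln_le_subr1 (r / s) (divr_gt0 r0 s0).
rewrite ln_div ?posrE// => h.
have {}h : s * s * (ln r - ln s) <= s * r - s * s.
  have -> : s * r - s * s = s * s * (r / s - 1) by field; rewrite gt_eqF.
  by rewrite ler_pM2l// mulr_gt0.
have h2 : (s * s - r * r) ^+ 2 / 4 <= (s - r) ^+ 2.
  have -> : (s * s - r * r) ^+ 2 / 4 = (s - r) ^+ 2 * ((s + r) / 2) ^+ 2.
    by field.
  rewrite ler_piMr ?sqr_ge0// expr_le1//; lra.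
apply: (le_trans h2); rewrite -subr_ge0; lra.
Qed.

End EntropyInequalities.

(** * Forward and backward recursions *)

Section ForwardBackward.
Variables (R : realType) (T : nat) (X U : nat -> finType).
Variables (p : forall t : 'I_T, X t -> U t -> X t.+1 -> R)
          (c : forall t : 'I_T, X t -> U t -> R)
          (cT : X T -> R) (mu1 : X 0%N -> R) (n : nat).
Hypothesis hp : forall (t : 'I_T) (x : X t) (u : U t), is_dist (p x u).
Hypothesis hmu1 : is_dist mu1.

Local Notation policy := (policy R T X U n).
Local Notation measures := (forall t : nat, X t -> window U n t -> R).
Local Notation outputs := (forall t : 'I_T, window U n t -> U t -> R).
Local Notation costs := (forall t : 'I_T, X t -> window U n t -> U t -> R).

Lemma time_ind_down (P : nat -> Prop) :
  P T -> (forall t : 'I_T, P t.+1 -> P t) -> forall t, (t <= T)%N -> P t.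
Proof.
move=> PT PS t tT; rewrite -(subKn tT).
elim: (T - t)%N (leq_subr t T) => [|s IH] sT; first by rewrite subn0.
have h : (T - s.+1 < T)%N by rewrite ltn_subrL /= (leq_ltn_trans _ sT).
by apply: (PS (Ordinal h)) => /=; rewrite subnSK//; apply: IH; exact: ltnW.
Qed.

(** Needed because a uniform law on the actions exists only if there are
    actions; nonemptiness propagates in time since the empty type carries no
    probability distribution. *)
Lemma state_window_inhabited (q : policy) : is_policy q ->
  forall t, (t <= T)%N -> inhabited (X t * window U n t).
Proof.
move=> hq; elim=> [|t IH] tT.
  have [x _] := is_dist_gt0_ex hmu1.
  exact: (inhabits (x, tt)).
have [[x w]] := IH (ltnW tT).
have [u _] := is_dist_gt0_ex (hq (Ordinal tT) x w).
have [x' _] := is_dist_gt0_ex (@hp (Ordinal tT) x u).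
exact: (inhabits (x', shift_window w u)).
Qed.

Lemma mu_system_ge0 (q : policy) (mu : measures) :
  (forall t z, 0 <= q t z) -> mu_system p mu1 q mu ->
  forall t, (t <= T)%N -> forall x w, 0 <= mu t x w.
Proof.
move=> q0 [mu0 muS]; elim=> [|t IH] tT x w; first by rewrite mu0; case: hmu1.
rewrite (muS (Ordinal tT)) /=.
apply: sumr_ge0 => y _; apply: sumr_ge0 => v _; apply: sumr_ge0 => u _.
have [p0 _] := @hp (Ordinal tT) y u.
by rewrite !mulr_ge0//; exact/IH/ltnW.
Qed.

(** The joint law of the action and the window preceding it. Contrary to
    [output_dist], it is a polynomial in [q] and [mu]. *)
Definition joint_output (q : policy) (mu : measures)
    (t : 'I_T) (w : window U n t) (u : U t) : R :=
  \sum_(x : X t) q t (x, w, u) * mu t x w.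

Lemma output_distE (q : policy) (mu : measures) (t : 'I_T) w u :
  output_dist q mu w u = joint_output q mu (t := t) w u / marginal (mu t) w.
Proof.
by rewrite mulr_suml; apply: eq_bigr => x _; rewrite /conditional mulrA.
Qed.

Lemma joint_output_sum (q : policy) (mu : measures) (t : 'I_T) w :
  is_policy q -> \sum_u joint_output q mu (t := t) w u = marginal (mu t) w.
Proof.
move=> hq; rewrite exchange_big; apply: eq_bigr => x _.
by have [_ q1] := hq t x w; rewrite -mulr_suml q1 mul1r.
Qed.

Lemma joint_output_null (q : policy) (mu : measures) (t : 'I_T) w u :
  (forall x, 0 <= mu t x w) -> marginal (mu t) w = 0 ->
  joint_output q mu (t := t) w u = 0.
Proof.
move=> mu0 /eqP; rewrite psumr_eq0// => /allP m0.
apply: big1 => x _; have /eqP -> := m0 x (mem_index_enum _); exact: mulr0.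
Qed.

Definition is_output_law (q : policy) (mu : measures) (nu : outputs) : Prop :=
  forall (t : 'I_T) w u,
    nu t w u = if marginal (mu t) w == 0 then #|U t|%:R^-1
               else output_dist q mu w u.

(** The product form of the equation for nu. It needs no exception for windows
    of probability 0, where both sides vanish, and it is stable under limits. *)
Lemma joint_output_law (q : policy) (mu : measures) (nu : outputs) :
  (forall t : 'I_T, forall x w, 0 <= mu t x w) -> is_output_law q mu nu ->
  forall (t : 'I_T) w u,
    joint_output q mu w u = marginal (mu t) w * nu t w u.
Proof.
move=> mu0 hnu t w u; rewrite hnu output_distE.
case: (eqVneq (marginal (mu t) w) 0) => [e|ne].
  by rewrite e mul0r joint_output_null.
by rewrite mulrC divfK.
Qed.

Lemma output_law_dist (q : policy) (mu : measures) (nu : outputs) :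
  is_policy q -> positive_policy q -> mu_system p mu1 q mu ->
  is_output_law q mu nu ->
  forall (t : 'I_T) w, is_dist (nu t w) /\ (forall u, 0 < nu t w u).
Proof.
move=> hq hq0 hmu hnu t w.
have mu0 x : 0 <= mu t x w.
  apply: (mu_system_ge0 _ hmu); last exact: ltnW.
  by move=> s [[y v] u]; exact/ltW/hq0.
have [[x0 _]] := state_window_inhabited hq (ltnW (ltn_ord t)).
have [u0 _] := is_dist_gt0_ex (hq t x0 w).
have U0 : (0 < #|U t|)%N by apply/card_gt0P; exists u0.
suff [H H1] : (forall u, 0 < nu t w u) /\ \sum_u nu t w u = 1.
  by split=> //; split=> // u; exact/ltW.
case: (eqVneq (marginal (mu t) w) 0) => [e|ne].
  have nuE u : nu t w u = #|U t|%:R^-1 by rewrite hnu e eqxx.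
  split=> [u|]; first by rewrite nuE invr_gt0 ltr0n.
  rewrite (eq_bigr _ (fun u _ => nuE u)) sumr_const -[_ *+ _]mulr_natr mulVf//.
  by rewrite pnatr_eq0 -lt0n.
have m0 : 0 < marginal (mu t) w by rewrite lt0r ne sumr_ge0.
have nuE u : nu t w u = joint_output q mu w u / marginal (mu t) w.
  by rewrite hnu (negbTE ne) output_distE.
split=> [u|]; last first.
  by rewrite (eq_bigr _ (fun u _ => nuE u)) -mulr_suml joint_output_sum ?divff.
rewrite nuE divr_gt0// lt0r sumr_ge0 ?andbT; last first.
  by move=> x _; rewrite mulr_ge0// ltW.
apply: contra_neq ne => /eqP; rewrite psumr_eq0; last first.
  by move=> x _; rewrite mulr_ge0// ltW.
move=> /allP z; apply: big1 => x _; apply/eqP.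
by have := z x (mem_index_enum _); rewrite /= mulf_eq0 gt_eqF.
Qed.

Lemma phi_gt0 (nu : outputs) (rho : costs) (phi : measures) :
  (forall (t : 'I_T) w, is_dist (nu t w)) ->
  rho_phi_system p c cT nu rho phi ->
  forall t, (t <= T)%N -> forall x w, 0 < phi t x w.
Proof.
move=> hnu [phiT _ phiE]; apply: time_ind_down => [|t _] x w.
  by rewrite phiT expR_gt0.
have [u u0] := is_dist_gt0_ex (hnu t w); have [nu0 _] := hnu t w.
rewrite phiE (bigD1 u)//= ltr_pwDl ?mulr_gt0 ?expR_gt0//.
by apply: sumr_ge0 => v _; rewrite mulr_ge0 ?expR_ge0.
Qed.

Definition is_gibbs_policy (nu : outputs) (rho : costs) (phi : measures)
    (q : policy) : Prop :=
  forall (t : 'I_T) x w u,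
    q t (x, w, u) = nu t w u * expR (- rho t x w u) / phi t x w.

Lemma gibbs_policyP (nu : outputs) (rho : costs) (phi : measures) (q : policy) :
  (forall (t : 'I_T) w, is_dist (nu t w)) ->
  (forall (t : 'I_T) w u, 0 < nu t w u) ->
  rho_phi_system p c cT nu rho phi -> is_gibbs_policy nu rho phi q ->
  is_policy q /\ positive_policy q.
Proof.
move=> dnu nu0 sys hq.
have ph0 (t : 'I_T) x w : 0 < phi t x w by apply: (phi_gt0 dnu sys); exact: ltnW.
have q0 : positive_policy q.
  by move=> t x w u; rewrite hq divr_gt0// mulr_gt0// expR_gt0.
split=> // t x w; split=> [u|]; first exact/ltW.
rewrite (eq_bigr _ (fun u _ => hq t x w u)) -mulr_suml.
by case: sys => _ _ <-; rewrite divff// gt_eqF.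
Qed.

(** Change of variables: [mu t.+1] is the image of the law of (state, window,
    action, next state) at time [t]. *)
Lemma mu_system_push (q : policy) (mu : measures) :
  mu_system p mu1 q mu ->
  forall (t : 'I_T) (g : X t.+1 -> window U n t.+1 -> R),
    \sum_x' \sum_v mu t.+1 x' v * g x' v =
    \sum_x \sum_w mu t x w *
      \sum_u q t (x, w, u) * \sum_x' p x u x' * g x' (shift_window w u).
Proof.
move=> [_ muS] t g.
transitivity (\sum_x' \sum_v \sum_x \sum_w \sum_(u | shift_window w u == v)
    p x u x' * q t (x, w, u) * mu t x w * g x' (shift_window w u)).
  apply: eq_bigr => x' _; apply: eq_bigr => v _; rewrite muS mulr_suml.
  apply: eq_bigr => x _; rewrite mulr_suml; apply: eq_bigr => w _.
  by rewrite mulr_suml; apply: eq_bigr => u /eqP ->.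
transitivity (\sum_x' \sum_x \sum_w \sum_u
    p x u x' * q t (x, w, u) * mu t x w * g x' (shift_window w u)).
  apply: eq_bigr => x' _; rewrite exchange_big; apply: eq_bigr => x _.
  rewrite exchange_big; apply: eq_bigr => w _.
  by rewrite [RHS](partition_big (fun u => shift_window w u) predT).
rewrite exchange_big; apply: eq_bigr => x _.
rewrite exchange_big; apply: eq_bigr => w _.
rewrite exchange_big mulr_sumr; apply: eq_bigr => u _.
rewrite !mulr_sumr; apply: eq_bigr => x' _; ring.
Qed.

(** * Ascent of the value in one iteration *)

(** The primed data are those of the iteration after the unprimed ones: [q] is
    built from [nu], and [nu'] is the output law of [q]. *)
Section Ascent.
Variables (nu nu' : outputs) (rho rho' : costs) (phi phi' : measures).
Arguments nu : clear implicits.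
Arguments nu' : clear implicits.
Arguments rho : clear implicits.
Arguments rho' : clear implicits.
Arguments phi : clear implicits.
Arguments phi' : clear implicits.
Hypothesis nu_dist : forall (t : 'I_T) w, is_dist (nu t w).
Hypothesis nu_gt0 : forall (t : 'I_T) w u, 0 < nu t w u.
Hypothesis nu'_dist : forall (t : 'I_T) w, is_dist (nu' t w).
Hypothesis nu'_gt0 : forall (t : 'I_T) w u, 0 < nu' t w u.
Hypothesis sys : rho_phi_system p c cT nu rho phi.
Hypothesis sys' : rho_phi_system p c cT nu' rho' phi'.

(** [phi'] is a sum of Gibbs weights, so Gibbs' variational inequality can be
    tested on [q], for which ln q = ln nu - rho - ln phi. The difference
    rho - rho' is the expected gain at the next state. *)
Lemma ln_phi_gain (q : policy) (t : 'I_T) x w :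
  is_gibbs_policy nu rho phi q ->
  \sum_u q t (x, w, u) * (ln (nu' t w u) - ln (nu t w u)) +
  \sum_u q t (x, w, u) *
    \sum_x' p x u x' * (ln (phi' t.+1 x' (shift_window w u)) -
                        ln (phi t.+1 x' (shift_window w u)))
  <= ln (phi' t x w) - ln (phi t x w).
Proof.
move=> hq; have [qP q0] := gibbs_policyP nu_dist nu_gt0 sys hq.
have ph0 : 0 < phi t x w by apply: (phi_gt0 nu_dist sys); exact: ltnW.
have [_ q1] := qP t x w.
have [_ rhoE _] := sys; have [_ rhoE' phiE'] := sys'.
rewrite lerBrDr phiE'.
have g0 u : 0 < nu' t w u * expR (- rho' t x w u) by rewrite mulr_gt0 ?expR_gt0.
apply: le_trans (gibbs_variational (qP t x w) (q0 t x w) g0).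
rewrite -big_split /= -[ln (phi t x w)]mul1r -q1 mulr_suml -big_split /=.
apply: ler_sum => u _; rewrite -!mulrDr ler_pM2l//.
rewrite hq ln_div ?posrE ?mulr_gt0 ?expR_gt0//.
rewrite !lnM ?posrE ?expR_gt0// !expRK rhoE rhoE'.
under eq_bigr do rewrite mulrBr.
rewrite sumrB -subr_ge0; lra.
Qed.

Definition expected_gain (mu : measures) (t : nat) : R :=
  \sum_x \sum_w mu t x w * (ln (phi' t x w) - ln (phi t x w)).

Variables (q : policy) (mu : measures).
Arguments q : clear implicits.
Arguments mu : clear implicits.
Hypothesis hq : is_gibbs_policy nu rho phi q.
Hypothesis hmu : mu_system p mu1 q mu.
Hypothesis hnu' : is_output_law q mu nu'.

Let mu_ge0 t : (t <= T)%N -> forall x w, 0 <= mu t x w.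
Proof.
apply: (mu_system_ge0 _ hmu) => s [[x w] u].
by apply/ltW; have [_ ->] := gibbs_policyP nu_dist nu_gt0 sys hq.
Qed.

(** [ln_phi_gain] averaged over [mu t]. Since the joint output of [q] factors
    as the marginal times [nu'], the average of ln (nu' / nu) is the relative
    entropy of [nu'] with respect to [nu], averaged over the windows. *)
Lemma expected_gain_step (t : 'I_T) :
  expected_gain mu t.+1 +
    \sum_w marginal (mu t) w * \sum_u (nu' t w u - nu t w u) ^+ 2 / 4
  <= expected_gain mu t.
Proof.
have mut x w : 0 <= mu t x w by apply: mu_ge0; exact: ltnW.
rewrite /expected_gain (mu_system_push hmu).
pose L w u := ln (nu' t w u) - ln (nu t w u).
have entropy_ge : \sum_w marginal (mu t) w * \sum_u (nu' t w u - nu t w u) ^+ 2 / 4 <=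
    \sum_x \sum_w mu t x w * \sum_u q t (x, w, u) * L w u.
  rewrite exchange_big; apply: ler_sum => w _ /=.
  have -> : \sum_x mu t x w * \sum_u q t (x, w, u) * L w u =
      marginal (mu t) w * \sum_u nu' t w u * L w u.
    under eq_bigr do rewrite mulr_sumr.
    rewrite exchange_big mulr_sumr; apply: eq_bigr => u _ /=.
    rewrite mulrA -(joint_output_law _ hnu') => [|s y v]; last first.
      by apply: mu_ge0; exact: ltnW.
    by rewrite mulr_suml; apply: eq_bigr => x _; ring.
  apply: ler_wpM2l; first exact: sumr_ge0.
  (* Both distributions have mass 1, so the added terms cancel in the sum. *)
  have -> : \sum_u nu' t w u * L w u =
      \sum_u (nu' t w u * L w u - nu' t w u + nu t w u).
    rewrite big_split sumrB /=.
    by have [_ ->] := nu_dist w; have [_ ->] := nu'_dist w; ring.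
  apply: ler_sum => u _; apply: relative_entropy_term_ge.
    by rewrite nu'_gt0 is_dist_le1.
  by rewrite nu_gt0 is_dist_le1.
apply: le_trans (lerD (lexx _) entropy_ge) _.
rewrite -big_split; apply: ler_sum => x _ /=.
rewrite -big_split; apply: ler_sum => w _ /=.
by rewrite -mulrDr ler_wpM2l// addrC ln_phi_gain.
Qed.

Lemma marginal_ge0 (t : 'I_T) w : 0 <= marginal (mu t) w.
Proof. by apply: sumr_ge0 => x _; apply: mu_ge0; exact: ltnW. Qed.

Lemma expected_gain_ge0 : forall t, (t <= T)%N -> 0 <= expected_gain mu t.
Proof.
apply: time_ind_down => [|t IH].
  have [phiT _ _] := sys; have [phiT' _ _] := sys'.
  rewrite /expected_gain big1// => x _; rewrite big1// => w _.
  by rewrite phiT phiT' subrr mulr0.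
apply: le_trans (expected_gain_step t); rewrite addr_ge0// sumr_ge0// => w _.
rewrite mulr_ge0 ?marginal_ge0// sumr_ge0// => u _.
by rewrite divr_ge0// sqr_ge0.
Qed.

(** The gain vanishes at the horizon, where [phi] is fixed by the terminal
    cost, and is nonincreasing in time; so the gain at time 0 dominates what is
    lost between any two consecutive times. *)
Lemma total_gain_ge (t : 'I_T) w u :
  marginal (mu t) w * ((nu' t w u - nu t w u) ^+ 2 / 4) <=
  expected_gain mu 0.
Proof.
have D0 (s : 'I_T) (v : window U n s) y :
    0 <= (nu' s v y - nu s v y) ^+ 2 / 4 by rewrite divr_ge0// sqr_ge0.
have DS0 (s : 'I_T) v : 0 <= marginal (mu s) v *
    \sum_y (nu' s v y - nu s v y) ^+ 2 / 4.
  by rewrite mulr_ge0 ?marginal_ge0// sumr_ge0.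
have mono s : (s <= T)%N -> expected_gain mu s <= expected_gain mu 0.
  elim: s => [//|s IH] sT; apply: le_trans (IH (ltnW sT)).
  apply: le_trans (expected_gain_step (Ordinal sT)).
  by rewrite lerDl sumr_ge0.
apply: le_trans (mono t (ltnW (ltn_ord t))).
apply: le_trans (expected_gain_step t).
rewrite ler_wpDl ?expected_gain_ge0// (bigD1 w)//= ler_wpDr ?sumr_ge0//.
by rewrite ler_wpM2l ?marginal_ge0// (bigD1 u)//= lerDl sumr_ge0.
Qed.

End Ascent.
End ForwardBackward.

(** * Limits along filters *)

Section Limits.
Variable R : realType.

Lemma cvg_sumr {I : Type} (F : set_system I) {FF : Filter F} (A : finType)
    (P : pred A) (f : A -> I -> R) (l : A -> R) :
  (forall a, P a -> f a i @[i --> F] --> l a) ->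
  \sum_(a | P a) f a i @[i --> F] --> \sum_(a | P a) l a.
Proof. by move=> fl; apply: cvg_big => //; exact: add_continuous. Qed.

Lemma cvg_expR {I : Type} (F : set_system I) {FF : Filter F} (f : I -> R)
    (l : R) : f i @[i --> F] --> l -> expR (f i) @[i --> F] --> expR l.
Proof. by move=> fl; apply: (continuous_cvg _ _ fl); exact: continuous_expR. Qed.

Lemma cvg_ln {I : Type} (F : set_system I) {FF : Filter F} (f : I -> R)
    (l : R) :
  0 < l -> f i @[i --> F] --> l -> ln (f i) @[i --> F] --> ln l.
Proof. by move=> l0 fl; apply: (continuous_cvg _ _ fl); exact: continuous_ln. Qed.

(** An ultrafilter spares the successive extraction of subsequences: every
    bounded sequence converges along it. *)
Lemma ultra_bounded_cvg {I : Type} (F : set_system I) {FU : UltraFilter F}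
    (f : I -> R) (a b : R) :
  (forall i, a <= f i <= b) -> exists l : R, f i @[i --> F] --> l.
Proof.
move=> fab.
have FP : ProperFilter F by exact: ultra_proper.
have FI : (f i @[i --> F]) `[a, b]%classic.
  by apply: (@filterE _ F) => i; rewrite /= in_itv /= fab.
have [l [_ lcl]] := @segment_compact R a b (f i @[i --> F]) _ FI.
exists l => B Bl; have [//|nB] := in_ultra_setVsetC (f @^-1` B) FU.
have [y [/= nBy By]] := lcl (~` B) B nB Bl; contradiction.
Qed.

(** Any ultrafilter finer than [F] and than the preimages of the neighborhoods
    of [s] will do; these generate a proper filter exactly because [s] is a
    cluster point. *)
Lemma cluster_ultra {I : Type} (S : topologicalType) (F : set_system I)
    {FF : Filter F} (f : I -> S) (s : S) :
  cluster (f i @[i --> F]) s ->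
  exists G : set_system I,
    [/\ UltraFilter G, F `<=` G & f i @[i --> G] --> s].
Proof.
move=> cl.
pose D := [set AB : set I * set S | F AB.1 /\ nbhs s AB.2].
pose H := filter_from D (fun AB => AB.1 `&` f @^-1` AB.2).
have HP : ProperFilter H.
  apply: filter_from_proper.
    apply: filter_from_filter.
      by exists (setT, setT); split; exact: filterT.
    move=> [A B] [A' B'] [/= FA nB] [/= FA' nB'].
    exists (A `&` A', B `&` B'); first by split; exact: filterI.
    by move=> i [[Ai A'i] [Bi B'i]].
  move=> [A B] [/= FA nB].
  have FfA : F (f @^-1` (f @` A)).
    by apply: filterS FA => i Ai; exists i.
  by have [_ [[i Ai <-] Bi]] := cl _ _ FfA nB; exists i.
have [G [GU HG]] := ultraFilterLemma HP.
exists G; split=> //.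
  move=> A FA; apply: HG; exists (A, setT) => [|i []//].
  by split=> //; exact: filterT.
move=> B nB; apply: HG; exists (setT, B) => [|i []//].
by split=> //; exact: filterT.
Qed.

End Limits.

(** * Continuity of the recursions *)

Section Continuity.
Variables (R : realType) (T : nat) (X U : nat -> finType).
Variables (p : forall t : 'I_T, X t -> U t -> X t.+1 -> R)
          (c : forall t : 'I_T, X t -> U t -> R)
          (cT : X T -> R) (mu1 : X 0%N -> R) (n : nat).

Local Notation policy := (policy R T X U n).
Local Notation measures := (forall t : nat, X t -> window U n t -> R).
Local Notation outputs := (forall t : 'I_T, window U n t -> U t -> R).
Local Notation costs := (forall t : 'I_T, X t -> window U n t -> U t -> R).

Variables (I : Type) (F : set_system I).
Context {FF : ProperFilter F}.

Lemma policy_entry_cvg (q : I -> policy) (q' : policy) :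
  q i @[i --> F] --> q' ->
  forall t z, q i t z @[i --> F] --> q' t z.
Proof.
move=> qq' t z.
have h1 : q i t @[i --> F] --> q' t.
  exact: (cvg_comp _ _ qq' (@proj_continuous _ _ t q')).
exact: (cvg_comp _ _ h1 (@proj_continuous _ _ z (q' t))).
Qed.

Lemma policy_box_compact (a b : R) :
  compact [set q : policy | forall t z, a <= q t z <= b].
Proof.
pose box (t : 'I_T) : set (prod_topology
    (fun _ : X t * window U n t * U t => R : topologicalType)) :=
  [set f | forall z, `[a, b]%classic (f z)].
have cbox t : compact (box t).
  apply: (@tychonoff _ (fun=> R : topologicalType) (fun=> `[a, b]%classic)).
  by move=> z; exact: segment_compact.
have := tychonoff cbox.
suff -> : [set f | forall t, box t (f t)] =
  [set q : policy | forall t z, a <= q t z <= b] by [].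
apply/seteqP; split=> f H t z; have := H t z; by rewrite /= in_itv.
Qed.

Lemma mu_system_cvg (q : I -> policy) (mu : I -> measures)
    (q' : policy) (mu' : measures) :
  (forall i, mu_system p mu1 (q i) (mu i)) -> mu_system p mu1 q' mu' ->
  (forall t z, q i t z @[i --> F] --> q' t z) ->
  forall t, (t <= T)%N -> forall x w, mu i t x w @[i --> F] --> mu' t x w.
Proof.
move=> hmu [mu0' muS'] qq'; elim=> [|t IH] tT x w.
  rewrite mu0'; under eq_fun => i do rewrite (hmu i).1.
  exact: cvg_cst.
rewrite (muS' (Ordinal tT)).
under eq_fun => i do rewrite ((hmu i).2 (Ordinal tT)).
apply: cvg_sumr => y _; apply: cvg_sumr => v _; apply: cvg_sumr => u _.
apply: cvgM; last exact/IH/ltnW.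
by apply: cvgM; [exact: cvg_cst | exact: qq'].
Qed.

(** The delicate point is ln phi, continuous only away from 0: the limit of
    phi is positive because the limit of nu is a distribution, hence charges
    some action. Positivity and convergence go down in time together. *)
Lemma rho_phi_system_cvg (nu : I -> outputs) (rho : I -> costs)
    (phi : I -> measures) (nu' : outputs) :
  (forall i, rho_phi_system p c cT (nu i) (rho i) (phi i)) ->
  (forall (t : 'I_T) w, is_dist (nu' t w)) ->
  (forall (t : 'I_T) w u, nu i t w u @[i --> F] --> nu' t w u) ->
  exists rho' phi', [/\ rho_phi_system p c cT nu' rho' phi',
    forall (t : 'I_T) x w u, rho i t x w u @[i --> F] --> rho' t x w u &
    forall t, (t <= T)%N -> forall x w, phi i t x w @[i --> F] --> phi' t x w].
Proof.
move=> sys dnu nunu'.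
pose rho' : costs := fun t x w u => lim (rho i t x w u @[i --> F]).
pose phi' : measures := fun t x w => lim (phi i t x w @[i --> F]).
have limE (f : I -> R) l : f i @[i --> F] --> l -> lim (f i @[i --> F]) = l.
  exact: cvg_lim.
have rho_cvg (t : 'I_T) :
    (forall x w, phi i t.+1 x w @[i --> F] --> phi' t.+1 x w) ->
    (forall x w, 0 < phi' t.+1 x w) -> forall x w u,
    rho i t x w u @[i --> F] --> c x u -
      \sum_x' p x u x' * ln (phi' t.+1 x' (shift_window w u)).
  move=> h h0 x w u.
  under eq_fun => i do (have [_ -> _] := sys i).
  apply: cvgB; first exact: cvg_cst.
  apply: cvg_sumr => x' _; apply: cvgM; first exact: cvg_cst.
  exact: cvg_ln.
have phi_cvg : forall t, (t <= T)%N ->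
    (forall x w, phi i t x w @[i --> F] --> phi' t x w) /\
    (forall x w, 0 < phi' t x w).
  apply: time_ind_down => [|t [IH IH0]].
    have h x w : phi i T x w @[i --> F] --> expR (- cT x).
      under eq_fun => i do (have [-> _ _] := sys i).
      exact: cvg_cst.
    have E x w : phi' T x w = expR (- cT x) by exact: limE.
    by split=> x w; rewrite E ?expR_gt0.
  have h x w : phi i t x w @[i --> F] --> \sum_u nu' t w u * expR (- (c x u -
      \sum_x' p x u x' * ln (phi' t.+1 x' (shift_window w u)))).
    under eq_fun => i do (have [_ _ ->] := sys i).
    apply: cvg_sumr => u _; apply: cvgM; first exact: nunu'.
    by apply: cvg_expR; apply: cvgN; exact: rho_cvg.
  have E x w := limE _ _ (h x w).
  split=> x w; rewrite /phi' E //.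
  have [u u0] := is_dist_gt0_ex (dnu t w); have [nu0 _] := dnu t w.
  rewrite (bigD1 u)//= ltr_pwDl ?mulr_gt0 ?expR_gt0//.
  by apply: sumr_ge0 => v _; rewrite mulr_ge0 ?expR_ge0.
have rho_cvg' (t : 'I_T) x w u : rho i t x w u @[i --> F] --> c x u -
      \sum_x' p x u x' * ln (phi' t.+1 x' (shift_window w u)).
  by apply: rho_cvg; have [] := phi_cvg t.+1 (ltn_ord t).
have rhoE (t : 'I_T) x w u : rho' t x w u = c x u -
      \sum_x' p x u x' * ln (phi' t.+1 x' (shift_window w u)).
  exact: limE.
exists rho', phi'; split=> [|t x w u|t tT x w]; last 2 first.
- by rewrite rhoE.
- by have [] := phi_cvg t tT.
split=> [x w|//|t x w]; apply: limE.
  under eq_fun => i do (have [-> _ _] := sys i).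
  exact: cvg_cst.
under eq_fun => i do (have [_ _ ->] := sys i).
apply: cvg_sumr => u _; apply: cvgM; first exact: nunu'.
by apply: cvg_expR; apply: cvgN; rewrite rhoE.
Qed.

End Continuity.

(** * Limits of the iteration *)

Section Trajectory.
Variables (R : realType) (T : nat) (X U : nat -> finType).
Variables (p : forall t : 'I_T, X t -> U t -> X t.+1 -> R)
          (c : forall t : 'I_T, X t -> U t -> R)
          (cT : X T -> R) (mu1 : X 0%N -> R) (n : nat).
Hypothesis hp : forall (t : 'I_T) (x : X t) (u : U t), is_dist (p x u).
Hypothesis hmu1 : is_dist mu1.

Variables (q : nat -> policy R T X U n)
  (mu : nat -> forall t : nat, X t -> window U n t -> R)
  (nu : nat -> forall t : 'I_T, window U n t -> U t -> R)
  (rho : nat -> forall t : 'I_T, X t -> window U n t -> U t -> R)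
  (phi : nat -> forall t : nat, X t -> window U n t -> R).
Arguments q : clear implicits.
Arguments mu : clear implicits.
Arguments nu : clear implicits.
Arguments rho : clear implicits.
Arguments phi : clear implicits.
Hypothesis q0_policy : is_policy (q 0%N).
Hypothesis q0_positive : positive_policy (q 0%N).
Hypothesis hmu : forall k, mu_system p mu1 (q k) (mu k).
Hypothesis hnu : forall k, is_output_law (q k) (mu k) (nu k).
Hypothesis hphi : forall k, rho_phi_system p c cT (nu k) (rho k) (phi k).
Hypothesis hgibbs : forall k, is_gibbs_policy (nu k) (rho k) (phi k) (q k.+1).

Lemma iterate_policy k : is_policy (q k) /\ positive_policy (q k).
Proof.
elim: k => [//|k [pk pk0]].
have dn := output_law_dist hp hmu1 pk pk0 (hmu k) (hnu k).
by apply: (gibbs_policyP _ _ (hphi k) (hgibbs k)) => t w; have [] := dn t w.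
Qed.

Lemma iterate_nu_dist k (t : 'I_T) w : is_dist (nu k t w).
Proof.
have [pk pk0] := iterate_policy k.
by have [] := output_law_dist hp hmu1 pk pk0 (hmu k) (hnu k) w.
Qed.

Lemma iterate_nu_gt0 k (t : 'I_T) w u : 0 < nu k t w u.
Proof.
have [pk pk0] := iterate_policy k.
by have [] := output_law_dist hp hmu1 pk pk0 (hmu k) (hnu k) w.
Qed.

Lemma iterate_mu_ge0 k t : (t <= T)%N -> forall x w, 0 <= mu k t x w.
Proof.
apply: (mu_system_ge0 hp hmu1 _ (hmu k)) => s [[x w] u].
by apply/ltW; have [_ ->] := iterate_policy k.
Qed.

(** The window at time 0 ranges over a one-point type; summing over it only
    keeps the form of [expected_gain] at time 0. *)
Definition value k : R := \sum_x \sum_w mu1 x * ln (phi k 0%N x w).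

Lemma expected_gain_value k :
  expected_gain (phi k) (phi k.+1) (mu k.+1) 0 = value k.+1 - value k.
Proof.
rewrite /value -sumrB; apply: eq_bigr => x _.
rewrite -sumrB; apply: eq_bigr => w _.
by rewrite (hmu k.+1).1 mulrBr.
Qed.

Lemma value_le k : value k <= value k.+1.
Proof.
rewrite -subr_ge0 -expected_gain_value.
exact: (expected_gain_ge0 hp hmu1 (iterate_nu_dist k) (iterate_nu_gt0 k)
  (iterate_nu_dist k.+1) (iterate_nu_gt0 k.+1) (hphi k) (hphi k.+1)
  (hgibbs k) (hmu k.+1) (hnu k.+1)).
Qed.

(** The defect is the marginal times the change of [nu], and [total_gain_ge]
    bounds its square with one factor of the marginal to spare. *)
Lemma sqr_defect_le k (t : 'I_T) w u :
  (joint_output (q k.+1) (mu k.+1) w u - marginal (mu k.+1 t) w * nu k t w u)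
    ^+ 2 <= marginal (mu k.+1 t) w * (4 * (value k.+1 - value k)).
Proof.
have := total_gain_ge hp hmu1 (iterate_nu_dist k) (iterate_nu_gt0 k)
  (iterate_nu_dist k.+1) (iterate_nu_gt0 k.+1) (hphi k) (hphi k.+1)
  (hgibbs k) (hmu k.+1) (hnu k.+1) w u.
rewrite expected_gain_value (joint_output_law _ (hnu k.+1)); last first.
  by move=> s; apply: iterate_mu_ge0; exact: ltnW.
move=> h; rewrite -mulrBr exprMn (expr2 (marginal _ _)) -mulrA.
apply: ler_wpM2l; last lra.
by apply: sumr_ge0 => x _; apply: iterate_mu_ge0; exact: ltnW.
Qed.

Lemma iterates_cluster : exists q', cluster (q k.+1 @[k --> \oo]) q'.
Proof.
have box : \forall k \near \oo, forall t z, 0 <= q k.+1 t z <= 1.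
  apply: nearW => k t [[x w] u]; have [pk _] := iterate_policy k.+1.
  by rewrite (pk t x w).1 (is_dist_le1 u (pk t x w)).
have [q' [_ cl]] :=
  @policy_box_compact R T X U n 0 1 (q k.+1 @[k --> \oo]) _ box.
by exists q'.
Qed.

(** The ultrafilter needs to be finer than the filter of large iteration
    numbers only to bound all values by their limit along it. *)
Lemma ultra_limit_optimality (G : set_system nat) (q' : policy R T X U n) :
  UltraFilter G -> \oo `<=` G -> q k.+1 @[k --> G] --> q' ->
  optimality_system p c cT mu1 q'.
Proof.
move=> GU Goo Gq'.
have GP : ProperFilter G by exact: ultra_proper.
have Gq := policy_entry_cvg Gq'.
pose nu' (t : 'I_T) (w : window U n t) (u : U t) := lim (nu k t w u @[k --> G]).
have Gnu (t : 'I_T) w u : nu k t w u @[k --> G] --> nu' t w u.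
  have [|l nul] := @ultra_bounded_cvg R _ G GU (fun k => nu k t w u) 0 1.
    by move=> k; rewrite ltW ?iterate_nu_gt0// is_dist_le1//;
      exact: iterate_nu_dist.
  by apply/cvg_ex; exists l.
have nu'_dist (t : 'I_T) (w : window U n t) : is_dist (nu' t w).
  split=> [u|].
    apply: cvgr_to_ge (Gnu t w u) _; apply: filterE => k.
    exact/ltW/iterate_nu_gt0.
  have h : \sum_u nu k t w u @[k --> G] --> \sum_u nu' t w u.
    by apply: cvg_sumr => u _; exact: Gnu.
  rewrite -(cvg_lim _ h)//; apply: cvg_lim => //.
  under eq_fun => k do (have [_ ->] := iterate_nu_dist k w).
  exact: cvg_cst.
have [rho' [phi' [sys' Grho Gphi]]] := rho_phi_system_cvg hphi nu'_dist Gnu.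
have [_ [mu' [_ [_ [_ [hmu' _ _ _]]]]]] := fb_ab_step_ex p c cT mu1 q'.
have Gmu := mu_system_cvg (fun k => hmu k.+1) hmu' Gq.
have phi'_gt0 := phi_gt0 nu'_dist sys'.
pose value' := \sum_x \sum_w mu1 x * ln (phi' 0%N x w).
have Gvalue : value k @[k --> G] --> value'.
  apply: cvg_sumr => x _; apply: cvg_sumr => w _.
  apply: cvgM; first exact: cvg_cst.
  by apply: cvg_ln; [exact: phi'_gt0 | exact: Gphi].
have value_max k : value k <= value'.
  apply: cvgr_to_ge Gvalue _; apply: Goo; exists k => // j /= kj.
  apply: (homo_leq (r := fun a b : R => a <= b)) kj => //.
    by move=> ? ? ?; exact: le_trans.
  exact: value_le.
have Ggain : value k.+1 - value k @[k --> G] --> (0 : R).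
  apply: (@squeeze_cvgr _ _ _ _ (fun=> 0) (fun k => value' - value k)).
  - by apply: filterE => k; rewrite subr_ge0 value_le lerB.
  - exact: cvg_cst.
  - by rewrite -(subrr value'); apply: cvgB => //; exact: cvg_cst.
have Gmarg (t : 'I_T) w :
    marginal (mu k.+1 t) w @[k --> G] --> marginal (mu' t) w.
  by apply: cvg_sumr => x _; apply: Gmu; exact: ltnW.
have joint' (t : 'I_T) w u :
    joint_output q' mu' w u = marginal (mu' t) w * nu' t w u.
  pose defect k := joint_output (q k.+1) (mu k.+1) w u -
    marginal (mu k.+1 t) w * nu k t w u.
  have Gdefect : defect k @[k --> G] -->
      joint_output q' mu' w u - marginal (mu' t) w * nu' t w u.
    apply: cvgB; last by apply: cvgM; [exact: Gmarg | exact: Gnu].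
    apply: cvg_sumr => x _.
    by apply: cvgM; [exact: Gq | apply: Gmu; exact: ltnW].
  have Gdefect0 : defect k ^+ 2 @[k --> G] --> (0 : R).
    apply: (@squeeze_cvgr _ _ _ _ (fun=> 0)
      (fun k => marginal (mu k.+1 t) w * (4 * (value k.+1 - value k)))).
    - by apply: filterE => k; rewrite sqr_ge0 sqr_defect_le.
    - exact: cvg_cst.
    - rewrite -[X in _ --> X](mulr0 (marginal (mu' t) w)); apply: cvgM => //.
      by rewrite -[X in _ --> X](mulr0 4); apply: cvgM => //; exact: cvg_cst.
  apply/eqP; rewrite -subr_eq0 -sqrf_eq0; apply/eqP.
  apply: (cvg_unique _ _ Gdefect0) => //.
  exact: (cvgM Gdefect Gdefect).
exists mu', nu', rho', phi'; split=> // t.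
  by move=> w u m0; rewrite output_distE joint' mulrC mulKf// gt_eqF.
move=> x w u _.
apply: (cvg_unique _ (Gq t (x, w, u))) => //.
rewrite (_ : (fun k => _) =
  (fun k => nu k t w u * expR (- rho k t x w u) / phi k t x w)); last first.
  by apply/funext => k; exact: hgibbs.
apply: cvgM; last first.
  apply: cvgV; last by apply: Gphi; exact: ltnW.
  by rewrite gt_eqF// phi'_gt0// ltnW.
apply: cvgM; first exact: Gnu.
by apply: cvg_expR; apply: cvgN; exact: Grho.
Qed.

End Trajectory.

Theorem theorem2 (R : realType) (T : nat) (hT : (1 <= T)%N)
    (X U : nat -> finType)
    (p : forall t : 'I_T, X t -> U t -> X t.+1 -> R)
    (hp : forall (t : 'I_T) (x : X t) (u : U t), is_dist (p t x u))
    (c : forall t : 'I_T, X t -> U t -> R) (cT : X T -> R)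
    (mu1 : X 0%N -> R) (hmu1 : is_dist mu1)
    (n : nat)
    (q0 : policy R T X U n) (hq0 : is_policy q0) (hq0pos : positive_policy q0)
    (q : nat -> policy R T X U n) (hq : fb_ab_sequence p c cT mu1 q0 q) :
  (exists qstar : policy R T X U n, cluster (q k.+1 @[k --> \oo]) qstar) /\
  (forall qstar : policy R T X U n,
     cluster (q k.+1 @[k --> \oo]) qstar ->
     optimality_system p c cT mu1 qstar).
Proof.
have [qz hstep] := hq.
pose iter_data := ((forall t : nat, X t -> window U n t -> R) *
  (forall t : 'I_T, window U n t -> U t -> R) *
  (forall t : 'I_T, X t -> window U n t -> U t -> R) *
  (forall t : nat, X t -> window U n t -> R))%type.
have /boolp.choice[D HD] : forall k, exists d : iter_data,
    [/\ mu_system p mu1 (q k) d.1.1.1,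
        is_output_law (q k) d.1.1.1 d.1.1.2,
        rho_phi_system p c cT d.1.1.2 d.1.2 d.2 &
        is_gibbs_policy d.1.1.2 d.1.2 d.2 (q k.+1)].
  by move=> k; have [mu [nu [rho [phi H]]]] := hstep k; exists (mu, nu, rho, phi).
rewrite -qz in hq0 hq0pos.
have hmu k : mu_system p mu1 (q k) (D k).1.1.1 by have [] := HD k.
have hnu k : is_output_law (q k) (D k).1.1.1 (D k).1.1.2 by have [] := HD k.
have hphi k : rho_phi_system p c cT (D k).1.1.2 (D k).1.2 (D k).2.
  by have [] := HD k.
have hgibbs k : is_gibbs_policy (D k).1.1.2 (D k).1.2 (D k).2 (q k.+1).
  by have [] := HD k.
split; first exact: (iterates_cluster hp hmu1 hq0 hq0pos hmu hnu hphi hgibbs).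
move=> qstar /cluster_ultra [G [GU Goo Gq]].
exact: (ultra_limit_optimality hp hmu1 hq0 hq0pos hmu hnu hphi hgibbs GU Goo Gq).
Qed.
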